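(* For each integer $r\geq 1$, the link $K_r$ represented by the diagram $\mathrm{den}(1\ast M_r)$ is a knot (i.e. has exactly one component) with at most $1+2^{r-1}\times 20$ crossings.
   Context: Tangles. A tangle is a tangle diagram in a disc with four boundary endpoints NW, NE, SW, SE. $T_1+T_2$ (horizontal sum) places $T_1$ to the left of $T_2$, joining the NE and SE endpoints of $T_1$ to the NW and SW endpoints of $T_2$ respectively. $T_1\ast T_2$ (vertical sum) places $T_1$ above $T_2$, joining the SW and SE endpoints of $T_1$ to the NW and NE endpoints of $T_2$ respectively. The tangle $1$ is a single crossing whose overstrand joins NW to SE and whose understrand joins SW to NE; the tangle $-1$ is a single crossing whose overstrand joins SW to NE and whose understrand joins NW to SE. For a tangle $T$, $-T$ is obtained from $T$ by switching all crossings. For a positive integer $k$: $k=1+\cdots+1$, $-k=(-1)+\cdots+(-1)$, $1/k=1\ast\cdots\ast 1$ and $-1/k=(-1)\ast\cdots\ast(-1)$, with $k$ terms each. $\mathrm{den}(T)$ is the link diagram obtained from $T$ by joining (outside the disc) NW to SW and NE to SE. Define $T_{10}=((((1/2)+1)\ast 2)+(-3))\ast 2$, $T_{20}=T_{10}+(-T_{10})$, $M_1=T_{20}$ and $M_r=M_{r-1}+M_{r-1}$ for $r\geq 2$. A link ''has at most $n$ crossings'' if its crossing number (minimal number of crossings over all its diagrams) is at most $n$. *)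

(* Defs.v *)
From mathcomp Require Import all_boot all_order all_algebra.
From mathcomp Require Import all_classical all_reals all_analysis.

Set Implicit Arguments.
Unset Strict Implicit.
Unset Printing Implicit Defensive.

Import Order.TTheory GRing.Theory Num.Theory.
Import numFieldNormedType.Exports.

Local Open Scope classical_set_scope.
Local Open Scope card_scope.
Local Open Scope ring_scope.

(* A point is ((x, y), z): diagrams are projections to the xy-plane along the
   z-axis, so the projection is fst, and the strand with the larger z-coordinate
   is the overstrand. *)
Definition plane (R : realType) : Type := (R * R)%type.
Definition space (R : realType) : Type := (plane R * R)%type.

(** * Polygonal links and link diagrams *)

(* A polygonal figure in space, given by the endpoints of its edges.  Edges are
   unoriented, and the order of the list is irrelevant. *)
Definition figure (R : realType) : Type := seq (space R * space R).

Definition edge (R : realType) (e : space R * space R) : set (R * R * R) :=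
  [set ((1 - t) * e.1.1.1 + t * e.2.1.1,
        (1 - t) * e.1.1.2 + t * e.2.1.2,
        (1 - t) * e.1.2 + t * e.2.2) | t in `[0, 1]%classic].

Definition point_set (R : realType) (D : figure R) : set (R * R * R) :=
  [set p | exists2 e, e \in D & edge e p].

Definition vertices (R : realType) (D : figure R) : seq (space R) :=
  unzip1 D ++ unzip2 D.

(* The edges form a disjoint union of embedded closed polygons: distinct edges
   meet only in common endpoints, and every vertex has degree two. *)
Definition polygonal_link (R : realType) (D : figure R) : Prop :=
  [/\ uniq D,
      forall e, e \in D -> e.1 != e.2,
      forall e f, e \in D -> f \in D -> e != f ->
        edge e `&` edge f `<=` [set e.1; e.2] `&` [set f.1; f.2]
    & forall v, v \in vertices D -> count_mem v (vertices D) = 2%N].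

(* General position with respect to the projection: no triple points, and no
   vertex projects onto a multiple point.  As whole edges cannot then project to
   a point or overlap, multiple points are transverse double points. *)
Definition regular_projection (R : realType) (D : figure R) : Prop :=
  (forall p q s, point_set D p -> point_set D q -> point_set D s ->
     p.1 = q.1 -> q.1 = s.1 -> [\/ p = q, q = s | p = s]) /\
  (forall v p, v \in vertices D -> point_set D p -> p.1 = v.1 -> p = v).

(* A link diagram is recorded as a polygonal link in general position; its
   over/under information is read off from the heights. *)
Definition link_diagram (R : realType) (D : figure R) : Prop :=
  polygonal_link D /\ regular_projection D.

Definition crossings (R : realType) (D : figure R) : set (R * R) :=
  [set c | exists p q, [/\ point_set D p, point_set D q, p <> q, p.1 = c & q.1 = c]].

(** * Links, components, crossing number *)

(* Equivalence of links is ambient isotopy of 3-space. *)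
Definition isotopic (R : realType) (K L : set (R * R * R)) : Prop :=
  exists H : R * (R * R * R) -> R * R * R,
    [/\ {within `[0, 1]%classic `*` [set: R * R * R], continuous H},
        (forall t, t \in `[0, 1] -> exists G : R * R * R -> R * R * R,
           [/\ continuous G, cancel (fun p => H (t, p)) G
             & cancel G (fun p => H (t, p))]),
        (forall p, H (0, p) = p)
      & (fun p => H (1, p)) @` K = L].

Definition diagram_of (R : realType) (D : figure R) (K : set (R * R * R)) :=
  link_diagram D /\ isotopic K (point_set D).

Definition components (R : realType) (K : set (R * R * R)) :
    set (set (R * R * R)) :=
  [set connected_component K x | x in K].

Definition is_knot (R : realType) (K : set (R * R * R)) : Prop :=
  components K #= `I_1.

Definition is_crossing_number (R : realType) (K : set (R * R * R)) (c : nat) :=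
  (exists2 D, diagram_of D K & crossings D #= `I_c) /\
  (forall D m, diagram_of D K -> crossings D #= `I_m -> (c <= m)%N).

Definition at_most_crossings (R : realType) (K : set (R * R * R)) (n : nat) :=
  exists2 c, is_crossing_number K c & (c <= n)%N.

(** * Tangles *)

(* Tangle diagrams live in the square [-1, 1]^2, as figures over it that meet its
   boundary exactly in the corners NW, NE, SW, SE, at height 0. *)
Section Corners.
Variable R : realType.
Definition NW : space R := (-1, 1, 0).
Definition NE : space R := (1, 1, 0).
Definition SW : space R := (-1, -1, 0).
Definition SE : space R := (1, -1, 0).
End Corners.
Arguments NW {R}.
Arguments NE {R}.
Arguments SW {R}.
Arguments SE {R}.

Definition map_figure (R : realType) (f : space R -> space R) (D : figure R) :
    figure R :=
  [seq (f e.1, f e.2) | e <- D].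

Definition place (R : realType) (a b : R) (p : space R) : space R :=
  (a + p.1.1 / 4, b + p.1.2 / 4, p.2 / 4).

(* The summands are put into two smaller squares, centred at (-1/2, 0) and
   (1/2, 0) for +, at (0, 1/2) and (0, -1/2) for *.  Straight segments join
   endpoints as prescribed, and the free endpoints to the corners. *)
Definition hsum (R : realType) (S T : figure R) : figure R :=
  let l := place (- 2^-1) 0 in
  let r := place 2^-1 0 in
  map_figure l S ++ map_figure r T ++
  [:: (NW, l NW); (SW, l SW); (l NE, r NW); (l SE, r SW); (r NE, NE); (r SE, SE)].

Definition vsum (R : realType) (S T : figure R) : figure R :=
  let u := place 0 2^-1 in
  let d := place 0 (- 2^-1) in
  map_figure u S ++ map_figure d T ++
  [:: (NW, u NW); (NE, u NE); (u SW, d NW); (u SE, d NE); (d SW, SW); (d SE, SE)].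

(* Reflection in the plane of projection switches all crossings. *)
Definition switch (R : realType) (T : figure R) : figure R :=
  map_figure (fun p => (p.1, - p.2)) T.

Declare Scope tangle_scope.
Delimit Scope tangle_scope with tangle.
Notation "S + T" := (hsum S T) : tangle_scope.
Notation "S * T" := (vsum S T) : tangle_scope.
Notation "- T" := (switch T) : tangle_scope.

(* The apex of the overstrand is off centre because a vertex must not project
   onto the crossing, which is at the origin. *)
Definition tangle1 (R : realType) : figure R :=
  [:: (NW, (- 2^-1, 2^-1, 1)); ((- 2^-1, 2^-1, 1), SE); (SW, NE)].

Definition tangleN1 (R : realType) : figure R :=
  [:: (SW, (- 2^-1, - 2^-1, 1)); ((- 2^-1, - 2^-1, 1), NE); (NW, SE)].

(* The tangles k, -k, 1/k and -1/k, for k >= 1 only. *)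
Definition tangle_pos (R : realType) (k : nat) : figure R :=
  iter k.-1 (fun T => (T + tangle1 R)%tangle) (tangle1 R).
Definition tangle_neg (R : realType) (k : nat) : figure R :=
  iter k.-1 (fun T => (T + tangleN1 R)%tangle) (tangleN1 R).
Definition tangle_inv (R : realType) (k : nat) : figure R :=
  iter k.-1 (fun T => (T * tangle1 R)%tangle) (tangle1 R).
Definition tangle_neginv (R : realType) (k : nat) : figure R :=
  iter k.-1 (fun T => (T * tangleN1 R)%tangle) (tangleN1 R).

Definition den (R : realType) (T : figure R) : figure R :=
  let w := (-2, 0, 0) in
  let e := (2, 0, 0) in
  T ++ [:: (NW, w); (w, SW); (NE, e); (e, SE)].

Definition T10 (R : realType) : figure R :=
  ((((tangle_inv R 2 + tangle1 R) * tangle_pos R 2) + tangle_neg R 3)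
     * tangle_pos R 2)%tangle.

Definition T20 (R : realType) : figure R := (T10 R + - T10 R)%tangle.

(* M R 0 is a junk value. *)
Fixpoint M (R : realType) (r : nat) : figure R :=
  match r with
  | 0 | 1 => T20 R
  | r'.+1 => (M R r' + M R r')%tangle
  end.

(* Main.v *)
Require Import Defs.
From mathcomp Require Import all_boot all_order all_algebra.
From mathcomp Require Import all_classical all_reals all_analysis.
From mathcomp Require Import zify ring lra.
Import Defs.

Set Implicit Arguments.
Unset Strict Implicit.
Unset Printing Implicit Defensive.

Import Order.TTheory GRing.Theory Num.Theory.
Import numFieldNormedType.Exports.

Local Open Scope classical_set_scope.
Local Open Scope card_scope.
Local Open Scope ring_scope.

(** The union of two diagrams that meet only in endpoints of their arcs is again
    a diagram, and its crossings are those of the two pieces.  A tangle sum is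
    such a union: two copies of the summands, shrunk into disjoint squares, and
    six disjoint segments, which touch the small squares only in their corners.
    Hence a sum of tangle diagrams with m and n crossings is a tangle diagram
    with m + n crossings ([tangle_hsum]).  Vertical sums need no separate
    argument, because the reflection in the diagonal through NW and SE exchanges
    them with horizontal sums ([vsumE]), and all the maps in use (shrinking,
    reflections of the square, reversal of heights) preserve diagrams and their
    crossings ([regular_map], [crossings_le_map]).  Starting from one crossing
    for 1 and -1, this gives 10 crossings for T10, 20 for T20, 2^(r-1) * 20 for
    M_r, and 1 + 2^(r-1) * 20 for 1 * M_r; closing up adds none
    ([link_diagram_den]).  This diagram bounds the minimum over all diagrams of
    the link.

    For the number of components, only the way in which a tangle joins its
    corners matters, as long as it has no closed component.  A tangle has type H
    if it joins NW to NE and SW to SE, type V if it joins NW to SW and NE to SE,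
    and type D if it joins NW to SE and SW to NE.  The types of sums are
    D + D = H + H = H, V + D = H + V = D + V = V, H + D = D for horizontal sums,
    and the reflection, which exchanges H with V and fixes D, gives D * D = V and
    V * H = D * H = H.  As 1 and -1 have type D,
      2 : H,   1/2 : V,   1/2 + 1 : V,   (1/2 + 1) * 2 : H,   -3 : D,
      ((1/2 + 1) * 2) + (-3) : D,   T10 : H,   T20 : H,   M_r : H,
      1 * M_r : H,
    and the outer arcs of the denominator join the two strands of a tangle of
    type H to a single closed curve ([den_knot]). *)

(** * Edges, vertices and point sets *)

Definition lerp (R : realType) (t : R) (p q : space R) : space R :=
  ((1 - t) * p.1.1 + t * q.1.1, (1 - t) * p.1.2 + t * q.1.2,
   (1 - t) * p.2 + t * q.2).

Lemma edgeP (R : realType) (e : space R * space R) (p : space R) :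
  edge e p <-> exists2 t, 0 <= t <= 1 & p = lerp t e.1 e.2.
Proof.
by split=> [[t /= + <-]|[t t01 ->]]; exists t.
Qed.

Lemma edge_fst (R : realType) (e : space R * space R) : edge e e.1.
Proof.
apply/edgeP; exists 0; first by rewrite lexx ler01.
by case: e.1 => [[x y] z]; rewrite /lerp subr0 !mul1r !mul0r !addr0.
Qed.

Lemma edge_snd (R : realType) (e : space R * space R) : edge e e.2.
Proof.
apply/edgeP; exists 1; first by rewrite lexx ler01.
by case: e.2 => [[x y] z]; rewrite /lerp subrr !mul1r !mul0r !add0r.
Qed.

Lemma edge_ends (R : realType) (e : space R * space R) (p : space R) :
  p \in [:: e.1; e.2] -> edge e p.
Proof.
by rewrite !inE => /orP[] /eqP ->; [exact: edge_fst|exact: edge_snd].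
Qed.

Lemma mem_verticesP (R : realType) (D : figure R) (v : space R) :
  reflect (exists2 e, e \in D & v \in [:: e.1; e.2]) (v \in vertices D).
Proof.
rewrite mem_cat; apply: (iffP orP).
  by move=> [] /mapP[e eD ->]; exists e => //; rewrite !inE eqxx ?orbT.
by move=> [e eD]; rewrite !inE => /orP[] /eqP ->; [left|right]; exact: map_f.
Qed.

Lemma vertices_point_set (R : realType) (D : figure R) (v : space R) :
  v \in vertices D -> point_set D v.
Proof. by move=> /mem_verticesP[e eD /edge_ends ev]; exists e. Qed.

Lemma vertices_cat (R : realType) (D E : figure R) (v : space R) :
  (v \in vertices (D ++ E)) = (v \in vertices D) || (v \in vertices E).
Proof.
rewrite /vertices /unzip1 /unzip2 !map_cat !mem_cat.
by rewrite -!orbA; congr (_ || _); rewrite orbCA.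
Qed.

Lemma point_set_cat (R : realType) (D E : figure R) :
  point_set (D ++ E) = point_set D `|` point_set E.
Proof.
apply/seteqP; split=> p /=.
  by move=> [e]; rewrite mem_cat => /orP[] ? ?; [left|right]; exists e.
by move=> [] [e eD pe]; exists e; rewrite // mem_cat eD ?orbT.
Qed.

Lemma point_set1 (R : realType) (e : space R * space R) :
  point_set [:: e] = edge e.
Proof.
apply/seteqP; split=> p /=; first by move=> [f]; rewrite inE => /eqP ->.
by move=> ep; exists e; rewrite ?inE.
Qed.

Lemma point_set_cons (R : realType) (e : space R * space R) (D : figure R) :
  point_set (e :: D) = edge e `|` point_set D.
Proof. by rewrite -(point_set1 e) -point_set_cat. Qed.

Lemma point_set_nil (R : realType) : point_set ([::] : figure R) = set0.
Proof. by apply/seteqP; split=> p //= -[]. Qed.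

(** Only up to order, since [vertices] lists all first endpoints before all
    second endpoints. *)
Lemma perm_vertices_cat (R : realType) (D E : figure R) :
  perm_eq (vertices (D ++ E)) (vertices D ++ vertices E).
Proof.
by apply/permP => a; rewrite /vertices /unzip1 /unzip2 !map_cat !count_cat; lia.
Qed.

(** * Gluing diagrams *)

Definition meet_at_ends (R : realType) (D : figure R) : Prop :=
  forall e f, e \in D -> f \in D -> e != f ->
    edge e `&` edge f `<=` [set e.1; e.2] `&` [set f.1; f.2].

(** The conditions on a link diagram except the one on degrees: this part also
    makes sense for tangles, and is local enough to be checked piece by piece. *)
Definition regular (R : realType) (D : figure R) : Prop :=
  [/\ uniq D, forall e, e \in D -> e.1 != e.2, meet_at_ends D
    & regular_projection D].

Lemma vertex_in_edge (R : realType) (D : figure R) (e : space R * space R)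
    (v : space R) :
  meet_at_ends D -> e \in D -> v \in vertices D -> edge e v ->
  [set e.1; e.2] v.
Proof.
move=> mD eD /mem_verticesP[f fD vf] ev.
have [ef|ef] := eqVneq e f.
  by move: vf; rewrite -ef !inE => /orP[] /eqP ->; [left|right].
by have [] := mD _ _ eD fD ef v (conj ev (edge_ends vf)).
Qed.

(** Two figures that may be glued: their projections meet only where the figures
    share an endpoint.  Asking that the common point be a vertex on both sides
    keeps it away from the crossings of either figure. *)
Definition apart (R : realType) (D E : figure R) : Prop :=
  forall p q, point_set D p -> point_set E q -> p.1 = q.1 ->
    [/\ p = q, p \in vertices D & q \in vertices E].

Lemma apart_catr (R : realType) (D E F : figure R) :
  apart D E -> apart D F -> apart D (E ++ F).
Proof.
move=> aE aF p q pD; rewrite point_set_cat => -[] qE pq.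
  by have [? ? h] := aE p q pD qE pq; rewrite vertices_cat h.
by have [? ? h] := aF p q pD qE pq; rewrite vertices_cat h orbT.
Qed.

Lemma apart_nil (R : realType) (D : figure R) : apart D [::].
Proof. by move=> p q _ [e]. Qed.

Lemma apart_cons (R : realType) (D E : figure R) (e : space R * space R) :
  apart D [:: e] -> apart D E -> apart D (e :: E).
Proof. exact: (@apart_catr _ D [:: e]). Qed.

Lemma apart_empty (R : realType) (D E : figure R) :
  (forall p q, point_set D p -> point_set E q -> p.1 <> q.1) -> apart D E.
Proof. by move=> dDE p q pD qE /(dDE _ _ pD qE). Qed.

Lemma apart_edge (R : realType) (e f : space R * space R) :
  (forall s t, 0 <= s <= 1 -> 0 <= t <= 1 ->
     (lerp s e.1 e.2).1 <> (lerp t f.1 f.2).1) -> apart [:: e] [:: f].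
Proof.
move=> d; apply: apart_empty => p q; rewrite !point_set1.
by move=> /edgeP[s s01 ->] /edgeP[t t01 ->]; exact: d.
Qed.

(** Consecutive edges of a polygonal arc, sharing the endpoint q. *)
Lemma apart_joint (R : realType) (p q r : space R) :
  (forall s t, 0 <= s <= 1 -> 0 <= t <= 1 ->
     (lerp s p q).1 = (lerp t q r).1 -> s = 1 /\ t = 0) ->
  apart [:: (p, q)] [:: (q, r)].
Proof.
move=> j u v; rewrite !point_set1 => /edgeP[s s01 ->] /edgeP[t t01 ->] /=.
move=> /(j s t s01 t01)[-> ->].
have -> : lerp 1 p q = q by case: q {j} => [[? ?] ?]; congr (_, _, _) => /=; ring.
have -> : lerp 0 q r = q by case: q {j} => [[? ?] ?]; congr (_, _, _) => /=; ring.
by split=> //; apply/mem_verticesP; [exists (p, q)|exists (q, r)];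
  rewrite !inE eqxx ?orbT.
Qed.

(** A common point is a vertex of D that lies on e, so it is an endpoint of e:
    otherwise e would meet an edge ending there in its interior. *)
Lemma apart_edges (R : realType) (D E : figure R) :
  apart D E -> meet_at_ends D -> meet_at_ends E ->
  forall e f, e \in D -> f \in E ->
    edge e `&` edge f `<=` [set e.1; e.2] `&` [set f.1; f.2].
Proof.
move=> aDE mD mE e f eD fE p [pe pf].
have [||_ vD vE] := aDE p p _ _ erefl; [by exists e|by exists f|].
by split; [exact: vertex_in_edge vD pe|exact: vertex_in_edge vE pf].
Qed.

Lemma edge_not_ends (R : realType) (e : space R * space R) :
  e.1 != e.2 -> exists2 p, edge e p & ~ [set e.1; e.2] p.
Proof.
move=> ne; exists (lerp 2^-1 e.1 e.2).
  by apply/edgeP; exists 2^-1 => //; lra.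
move: ne; case: e => [[[x y] z] [[x' y'] z']] /= /eqP ne.
by move=> [] [? ? ?]; apply: ne; congr (_, _, _); lra.
Qed.

(** An edge occurring in both figures would meet itself in its endpoints only,
    but its midpoint is not an endpoint. *)
Lemma uniq_cat_meet (R : realType) (D E : figure R) :
  uniq D -> uniq E -> (forall e, e \in D -> e.1 != e.2) ->
  (forall e f, e \in D -> f \in E ->
    edge e `&` edge f `<=` [set e.1; e.2] `&` [set f.1; f.2]) ->
  uniq (D ++ E).
Proof.
move=> uD uE nD mDE; rewrite cat_uniq uD uE andbT; apply/hasPn => e eE.
apply/negP => /= eD; have [p ep] := edge_not_ends (nD e eD).
by case: (mDE e e eD eE p (conj ep ep)).
Qed.

Lemma meet_at_ends_cat (R : realType) (D E : figure R) :
  meet_at_ends D -> meet_at_ends E ->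
  (forall e f, e \in D -> f \in E ->
    edge e `&` edge f `<=` [set e.1; e.2] `&` [set f.1; f.2]) ->
  meet_at_ends (D ++ E).
Proof.
move=> mD mE mDE e f; rewrite !mem_cat => /orP[] eH /orP[] fH ef.
- exact: mD.
- exact: mDE.
- by rewrite setIC [X in _ `<=` X]setIC; exact: mDE.
- exact: mE.
Qed.

(** Of three points over the same place, two lie in the same piece or a point of
    one piece lies over a point of the other; in the mixed cases they coincide
    because the pieces are apart. *)
Lemma regular_cat (R : realType) (D E : figure R) :
  regular D -> regular E -> apart D E -> regular (D ++ E).
Proof.
move=> [uD nD mD [tD vD]] [uE nE mE [tE vE]] aDE.
have mDE := apart_edges aDE mD mE.
have aDE' p q : point_set D p -> point_set E q -> p.1 = q.1 -> p = q.
  by move=> pD qE /(aDE _ _ pD qE)[].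
split; [exact: uniq_cat_meet| |exact: meet_at_ends_cat|split].
- by move=> e; rewrite mem_cat => /orP[/nD|/nE].
- move=> p q s; rewrite !point_set_cat => -[] pH [] qH [] sH pq qs.
  + exact: tD.
  + by constructor 2; exact: aDE'.
  + by constructor 1; exact: aDE'.
  + by constructor 1; exact: aDE'.
  + by constructor 1; apply/esym/aDE'.
  + by constructor 1; apply/esym/aDE'.
  + by constructor 2; apply/esym/aDE'.
  + exact: tE.
- move=> v p; rewrite vertices_cat point_set_cat => /orP[] vH [] pH pv.
  + exact: vD.
  + by apply/esym/aDE' => //; exact: vertices_point_set.
  + by apply: aDE' => //; exact: vertices_point_set.
  + exact: vE.
Qed.

(** No crossings: the projection is injective. *)
Definition simple (R : realType) (D : figure R) : Prop :=
  forall p q, point_set D p -> point_set D q -> p.1 = q.1 -> p = q.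

Lemma simple_cat (R : realType) (D E : figure R) :
  simple D -> simple E -> apart D E -> simple (D ++ E).
Proof.
move=> sD sE aDE p q; rewrite !point_set_cat => -[] pH [] qH pq.
- exact: sD.
- by have [] := aDE p q pH qH pq.
- by have [] := aDE q p qH pH (esym pq).
- exact: sE.
Qed.

(** The opposite way of combining two pieces, used for the single crossing of
    the tangle 1: two arcs without self-crossings that cross each other away from
    their vertices.  A triple point is impossible, as two of its points would lie
    on the same arc. *)
Lemma regular_cross (R : realType) (D E : figure R) :
  regular D -> regular E -> simple D -> simple E ->
  (forall p q, point_set D p -> point_set E q -> p.1 = q.1 ->
     [/\ p <> q, p \notin vertices D & q \notin vertices E]) ->
  regular (D ++ E).
Proof.
move=> [uD nD mD [_ vD]] [uE nE mE [_ vE]] sD sE cDE.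
have mDE e f : e \in D -> f \in E ->
    edge e `&` edge f `<=` [set e.1; e.2] `&` [set f.1; f.2].
  move=> eD fE p [pe pf].
  by have [||//] := cDE p p _ _ erefl; [exists e|exists f].
split; [exact: uniq_cat_meet| |exact: meet_at_ends_cat|split].
- by move=> e; rewrite mem_cat => /orP[/nD|/nE].
- move=> p q s; rewrite !point_set_cat => -[] pH [] qH [] sH pq qs.
  1,2: by constructor 1; exact: sD.
  1: by constructor 3; apply: sD => //; rewrite pq.
  1: by constructor 2; exact: sE.
  1: by constructor 2; exact: sD.
  1: by constructor 3; apply: sE => //; rewrite pq.
  1,2: by constructor 1; exact: sE.
- move=> v p; rewrite vertices_cat point_set_cat => /orP[] vH [] pH pv.
  + exact: vD.
  + have [_] := cDE _ _ (vertices_point_set vH) pH (esym pv).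
    by rewrite vH.
  + have [_ _] := cDE _ _ pH (vertices_point_set vH) pv.
    by rewrite vH.
  + exact: vE.
Qed.

(** An edge with distinct projected endpoints is parametrized injectively by its
    projection. *)
Lemma simple1 (R : realType) (e : space R * space R) :
  e.1.1 != e.2.1 -> simple [:: e].
Proof.
move=> ne p q; rewrite point_set1 => /edgeP[t _ ->] /edgeP[s _ ->].
move: ne; case: e => [[[x y] z] [[x' y'] z']] /= ne [ex ey].
suff -> : t = s by [].
apply/eqP; rewrite -subr_eq0; apply/contraNT: ne => ts; apply/eqP.
by congr (_, _); apply/eqP; rewrite -subr_eq0;
  apply/eqP/(mulfI ts); rewrite mulr0; lra.
Qed.

Lemma regular1 (R : realType) (e : space R * space R) :
  e.1.1 != e.2.1 -> regular [:: e].
Proof.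
move=> ne; have se := simple1 ne; split=> //.
- by move=> f; rewrite inE => /eqP ->; apply: contra_neq ne => ->.
- by move=> f g; rewrite !inE => /eqP -> /eqP ->; rewrite eqxx.
- split=> [p q s pe qe _ pq _|v p /vertices_point_set ve pe pv].
    by constructor 1; exact: se.
  exact: se.
Qed.

Lemma regular_simple_cons (R : realType) (e : space R * space R) (D : figure R) :
  e.1.1 != e.2.1 -> apart [:: e] D -> regular D /\ simple D ->
  regular (e :: D) /\ simple (e :: D).
Proof.
move=> ne aeD [rD sD]; split.
  exact: (regular_cat (regular1 ne) rD aeD).
exact: (simple_cat (simple1 ne) sD aeD).
Qed.

Lemma regular_simple_nil (R : realType) :
  regular ([::] : figure R) /\ simple ([::] : figure R).
Proof.
by split; [split=> //; split=> [p q s [e]|v p]|move=> p q [e]].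
Qed.

(** * Bounding the number of crossings *)

(** A covering list bounds the number of crossings; unlike a cardinality, it
    passes to unions and images without any care for repetitions. *)
Definition crossings_le (R : realType) (D : figure R) (n : nat) : Prop :=
  exists2 s : seq (R * R), (size s <= n)%N & crossings D `<=` [set` s].

Lemma crossings_le_simple (R : realType) (D : figure R) :
  simple D -> crossings_le D 0.
Proof.
by move=> sD; exists [::] => // c [p [q [pD qD pq pc qc]]]; case: pq; apply: sD;
  rewrite // pc.
Qed.

(** No new crossings arise, because points of D and E with the same projection
    are equal. *)
Lemma crossings_le_cat (R : realType) (D E : figure R) (m n : nat) :
  apart D E -> crossings_le D m -> crossings_le E n ->
  crossings_le (D ++ E) (m + n).
Proof.
move=> aDE [s sm Ds] [t tn Et]; exists (s ++ t).
  by rewrite size_cat leq_add.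
move=> c [p [q []]]; rewrite !point_set_cat /= mem_cat => -[] pH [] qH pq pc qc.
- by apply/orP; left; apply: Ds; exists p, q.
- by have [] := aDE p q pH qH; rewrite ?pc.
- by have [|/esym] := aDE q p qH pH; rewrite ?pc.
- by apply/orP; right; apply: Et; exists p, q.
Qed.

Lemma crossings_finite (R : realType) (D : figure R) (n : nat) :
  crossings_le D n -> exists2 m, (m <= n)%N & crossings D #= `I_m.
Proof.
move=> [s sn Ds].
have [m Dm] : finite_set (crossings D) by exact: sub_finite_set (finite_seq s).
exists m => //; apply: leq_trans sn; rewrite -card_le_II -(card_le_eql Dm).
apply: card_le_trans (card_image_le (nth 0 s) `I_(size s)).
apply: subset_card_le => c /Ds /= cs.
by exists (index c s); rewrite /= ?index_mem ?nth_index.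
Qed.

(** * Rescalings and reflections *)

(** Maps that carry diagrams to diagrams: they preserve segments, and two points
    lie over the same place if and only if their images do.  Continuity is there
    to carry along connected components. *)
Record planar (R : realType) (f : space R -> space R) : Prop := Planar {
  planar_lerp : forall t p q, f (lerp t p q) = lerp t (f p) (f q);
  planar_inj : injective f;
  planar_fst : forall p q, (f p).1 = (f q).1 <-> p.1 = q.1;
  planar_continuous : continuous (f : R * R * R -> R * R * R) }.

(** The reflection in the diagonal through NW and SE, which exchanges SW and NE. *)
Definition flip (R : realType) (p : space R) : space R := (- p.1.2, - p.1.1, p.2).

(** The reflection exchanging north and south, which turns 1 into -1 since it
    keeps the heights. *)
Definition mirror (R : realType) (p : space R) : space R := (p.1.1, - p.1.2, p.2).

Definition reflect_height (R : realType) (p : space R) : space R := (p.1, - p.2).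

Section Continuity.
Variable R : realType.
Let x_cts (p : R * R * R) : (fun q : R * R * R => q.1.1) @ p --> p.1.1.
Proof. by apply: (@cvg_comp _ _ _ fst fst); [exact: cvg_fst|exact: cvg_fst]. Qed.
Let y_cts (p : R * R * R) : (fun q : R * R * R => q.1.2) @ p --> p.1.2.
Proof. by apply: (@cvg_comp _ _ _ fst snd); [exact: cvg_fst|exact: cvg_snd]. Qed.
Let z_cts (p : R * R * R) : (fun q : R * R * R => q.2) @ p --> p.2.
Proof. exact: cvg_snd. Qed.

Lemma cvg_triple (T : Type) (F : set_system T) (FF : Filter F)
    (f g h : T -> R) (a b c : R) :
  f @ F --> a -> g @ F --> b -> h @ F --> c ->
  (fun t => (f t, g t, h t) : R * R * R) @ F --> (a, b, c).
Proof. by move=> fa gb hc; exact: (cvg_pair (cvg_pair fa gb) hc). Qed.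

Lemma planar_place (a b : R) : planar (place a b).
Proof.
split.
- by move=> t [[x y] z] [[x' y'] z']; congr (_, _, _) => /=; ring.
- by move=> [[x y] z] [[x' y'] z'] [] /= *; congr (_, _, _); lra.
- by move=> [[x y] z] [[x' y'] z'] /=; split=> -[] /= *; congr (_, _); lra.
- move=> p; apply: cvg_triple.
  + by apply: cvgD; [exact: cvg_cst|apply: cvgMr_tmp; exact: x_cts].
  + by apply: cvgD; [exact: cvg_cst|apply: cvgMr_tmp; exact: y_cts].
  + by apply: cvgMr_tmp; exact: z_cts.
Qed.

Lemma planar_flip : planar (@flip R).
Proof.
split.
- by move=> t [[x y] z] [[x' y'] z']; congr (_, _, _) => /=; ring.
- by move=> [[x y] z] [[x' y'] z'] [] /= *; congr (_, _, _); lra.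
- by move=> [[x y] z] [[x' y'] z'] /=; split=> -[] /= *; congr (_, _); lra.
- move=> p; apply: cvg_triple; [| |exact: z_cts].
  + by apply: cvgN; exact: y_cts.
  + by apply: cvgN; exact: x_cts.
Qed.

Lemma planar_mirror : planar (@mirror R).
Proof.
split.
- by move=> t [[x y] z] [[x' y'] z']; congr (_, _, _) => /=; ring.
- by move=> [[x y] z] [[x' y'] z'] [] /= *; congr (_, _, _); lra.
- by move=> [[x y] z] [[x' y'] z'] /=; split=> -[] /= *; congr (_, _); lra.
- move=> p; apply: cvg_triple; [| |exact: z_cts].
  + exact: x_cts.
  + by apply: cvgN; exact: y_cts.
Qed.

Lemma planar_reflect_height : planar (@reflect_height R).
Proof.
split.
- by move=> t [[x y] z] [[x' y'] z']; congr (_, _, _) => /=; ring.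
- by move=> [[x y] z] [[x' y'] z'] [] /= *; congr (_, _, _); lra.
- by move=> [[x y] z] [[x' y'] z'] /=; split=> -[] /= *; congr (_, _); lra.
- (* Spelled out with three coordinates, to fit [cvg_triple]. *)
  have -> : @reflect_height R = fun p => (p.1.1, p.1.2, - p.2).
    by apply/funext => -[[x y] z].
  move=> p; apply: cvg_triple; [exact: x_cts|exact: y_cts|].
  by apply: cvgN; exact: z_cts.
Qed.

Lemma lerp_continuous (p q : space R) :
  continuous (fun t : R => lerp t p q : R * R * R).
Proof.
move=> t.
have c (a b : R) : (fun s : R => (1 - s) * a + s * b) @ t --> (1 - t) * a + t * b.
  apply: cvgD; apply: cvgMr_tmp; last exact: cvg_id.
  by apply: cvgB; [exact: cvg_cst|exact: cvg_id].
by apply: cvg_triple; exact: c.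
Qed.

End Continuity.

Lemma edge_map (R : realType) (f : space R -> space R) (e : space R * space R) :
  planar f -> edge (f e.1, f e.2) = f @` edge e.
Proof.
move=> pf; apply/seteqP; split=> p.
  move=> /edgeP[t t01 ->]; exists (lerp t e.1 e.2); last exact: planar_lerp.
  by apply/edgeP; exists t.
move=> [q /edgeP[t t01 ->] <-]; apply/edgeP; exists t => //.
exact: planar_lerp.
Qed.

Lemma point_set_map (R : realType) (f : space R -> space R) (D : figure R) :
  planar f -> point_set (map_figure f D) = f @` point_set D.
Proof.
move=> pf; apply/seteqP; split=> p.
  move=> [_ /mapP[e eD ->]]; rewrite edge_map // => -[q eq <-].
  by exists q => //; exists e.
move=> [q [e eD eq] <-]; exists (f e.1, f e.2);
  first exact: (map_f (fun e => (f e.1, f e.2))).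
by rewrite edge_map //; exists q.
Qed.

Lemma vertices_map (R : realType) (f : space R -> space R) (D : figure R) :
  vertices (map_figure f D) = map f (vertices D).
Proof. by rewrite /vertices /unzip1 /unzip2 map_cat -!map_comp. Qed.

Lemma regular_map (R : realType) (f : space R -> space R) (D : figure R) :
  planar f -> regular D -> regular (map_figure f D).
Proof.
move=> pf [uD nD mD [tD vD]]; have fI := planar_inj pf.
split.
- rewrite map_inj_uniq // => -[p q] [p' q'] [/= /fI -> /fI ->] //.
- move=> _ /mapP[e eD ->] /=; rewrite (inj_eq fI); exact: nD.
- move=> _ _ /mapP[e eD ->] /mapP[g gD ->] eg p; rewrite !edge_map //=.
  move=> [[q eq <-] [q' gq' /fI qq']]; move: gq'; rewrite qq' => gq.
  have ne : e != g by apply: contra_neq eg => ->.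
  by have [[->|->] [->|->]] := mD e g eD gD ne q (conj eq gq);
    split; by [left|right].
- split=> [p q s|v p]; rewrite point_set_map //.
    move=> [p' pD <-] [q' qD <-] [s' sD <-] /(planar_fst pf) pq /(planar_fst pf) qs.
    by have [->|->|->] := tD p' q' s' pD qD sD pq qs;
      [constructor 1|constructor 2|constructor 3].
  rewrite vertices_map => /mapP[v' vD' ->] [p' pD <-] /(planar_fst pf) pv.
  by rewrite (vD v' p').
Qed.

(** The projection of [f p] depends only on that of [p], so the images of the
    crossings are computed from arbitrary lifts, here of height 0. *)
Lemma crossings_le_map (R : realType) (f : space R -> space R) (D : figure R)
    (n : nat) :
  planar f -> crossings_le D n -> crossings_le (map_figure f D) n.
Proof.
move=> pf [s sn Ds]; exists [seq (f (c, 0)).1 | c <- s]; first by rewrite size_map.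
move=> c [p [q []]]; rewrite point_set_map // => -[p' pD <-] [q' qD <-] pq <-.
move=> /(planar_fst pf) qp /=.
have -> : (f p').1 = (f (p'.1, 0)).1 by apply/(planar_fst pf).
apply: (map_f (fun c => (f (c, 0)).1)); apply: Ds; exists p', q'; split=> //.
by move=> pq'; apply: pq; rewrite pq'.
Qed.

(** * Tangle diagrams *)

Definition corners (R : realType) : seq (space R) := [:: NW; NE; SW; SE].

Lemma NW_corner (R : realType) : NW \in corners R.
Proof. exact: (@mem_nth _ NW (corners R) 0 isT). Qed.
Lemma NE_corner (R : realType) : NE \in corners R.
Proof. exact: (@mem_nth _ NW (corners R) 1 isT). Qed.
Lemma SW_corner (R : realType) : SW \in corners R.
Proof. exact: (@mem_nth _ NW (corners R) 2 isT). Qed.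
Lemma SE_corner (R : realType) : SE \in corners R.
Proof. exact: (@mem_nth _ NW (corners R) 3 isT). Qed.

Definition in_square (R : realType) (p : space R) : Prop :=
  -1 <= p.1.1 <= 1 /\ -1 <= p.1.2 <= 1.

(** A tangle diagram with at most n crossings.  The third condition says that the
    four corners are ends of degree one and that all other vertices have degree
    two: s lists the interior vertices without repetition, each occurring at the
    end of two edges. *)
Record tangle (R : realType) (n : nat) (T : figure R) : Prop := Tangle {
  tangle_regular : regular T;
  tangle_in_square : forall p, point_set T p -> in_square p;
  tangle_ends : exists2 s, perm_eq (vertices T) (corners R ++ s ++ s)
                         & uniq (corners R ++ s);
  tangle_crossings : crossings_le T n }.

Lemma tangle_corner (R : realType) (n : nat) (T : figure R) (c : space R) :
  tangle n T -> c \in corners R -> c \in vertices T.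
Proof.
by move=> /tangle_ends[s /perm_mem -> _] cC; rewrite mem_cat cC.
Qed.

Lemma ends_in_square (R : realType) (n : nat) (T : figure R) (s : seq (space R))
    (x : space R) :
  tangle n T -> perm_eq (vertices T) (corners R ++ s ++ s) ->
  x \in corners R ++ s -> in_square x.
Proof.
move=> tT sE xs; apply: (tangle_in_square tT); apply: vertices_point_set.
by rewrite (perm_mem sE); move: xs; rewrite !mem_cat => /orP[] ->; rewrite ?orbT.
Qed.

Lemma apart_outside (R : realType) (f : space R -> space R) (n : nat)
    (T : figure R) (e : space R * space R) :
  planar f -> tangle n T ->
  (forall u t, in_square u -> 0 <= t <= 1 ->
     (f u).1 <> (lerp t e.1 e.2).1) ->
  apart (map_figure f T) [:: e].
Proof.
move=> pf tT d; apply: apart_empty => p q.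
rewrite point_set1 (point_set_map _ pf).
by move=> [u /(tangle_in_square tT) uI <-] /edgeP[t t01 ->]; exact: d.
Qed.

(** A segment issuing from a corner of a (transformed) tangle, touching the
    square only there.  By regularity no other point of the tangle lies over a
    corner, so it suffices to compute the intersection with the whole square. *)
Lemma apart_at_corner (R : realType) (c : space R) (f : space R -> space R)
    (n : nat) (T : figure R) (e : space R * space R) :
  planar f -> tangle n T -> c \in corners R -> e.1 = f c \/ e.2 = f c ->
  (forall u t, in_square u -> 0 <= t <= 1 ->
     (f u).1 = (lerp t e.1 e.2).1 ->
     u.1 = c.1 /\ lerp t e.1 e.2 = f c) ->
  apart (map_figure f T) [:: e].
Proof.
move=> pf tT cC ce d p q; have cT := tangle_corner tT cC.
rewrite point_set1 (point_set_map _ pf).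
move=> [u uT <-] /edgeP[t t01 ->] /(d u t (tangle_in_square tT uT) t01)[uc ->].
have [_ _ _ [_ vT]] := tangle_regular tT; rewrite (vT c u) //; split=> //.
  by rewrite vertices_map map_f.
by apply/mem_verticesP; exists e; rewrite !inE // -[f c == e.1]eq_sym
  -[f c == e.2]eq_sym; case: ce => ->; rewrite eqxx ?orbT.
Qed.

Lemma apart_places (R : realType) (a b a' b' : R) (m n : nat)
    (S T : figure R) :
  tangle m S -> tangle n T ->
  (forall u v, in_square u -> in_square v ->
    (place a b u).1 <> (place a' b' v).1) ->
  apart (map_figure (place a b) S) (map_figure (place a' b') T).
Proof.
move=> tS tT d; apply: apart_empty => p q; rewrite !point_set_map; try exact: planar_place.
by move=> [u /(tangle_in_square tS) uS <-] [v /(tangle_in_square tT) vT <-]; exact: d.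
Qed.

(** * Sums of tangle diagrams *)

(** The six connecting segments of a horizontal sum. *)
Definition hsum_strands (R : realType) : figure R :=
  let l := place (- 2^-1) 0 in
  let r := place 2^-1 0 in
  [:: (NW, l NW); (SW, l SW); (l NE, r NW); (l SE, r SW); (r NE, NE); (r SE, SE)].

Ltac outside := move=> [[? ?] ?] ? [/= ? ?] ? [] *; lra.
Ltac corner_only :=
  move=> [[? ?] ?] ? [/= ? ?] ? [] *;
  split; [congr (_, _)|congr (_, _, _)] => /=; lra.
Ltac at_fst pf tT cC :=
  apply: (apart_at_corner pf tT cC); [by left|corner_only].
Ltac at_snd pf tT cC :=
  apply: (apart_at_corner pf tT cC); [by right|corner_only].

Lemma apart_left_strands (R : realType) (n : nat) (T : figure R) :
  tangle n T -> apart (map_figure (place (- 2^-1) 0) T) (hsum_strands R).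
Proof.
move=> tT; rewrite /hsum_strands; have pf := planar_place (- 2^-1 : R) 0.
apply: apart_cons; first at_snd pf tT (NW_corner R).
apply: apart_cons; first at_snd pf tT (SW_corner R).
apply: apart_cons; first at_fst pf tT (NE_corner R).
apply: apart_cons; first at_fst pf tT (SE_corner R).
by do 2![apply: apart_cons; [apply: (apart_outside pf tT); outside|]]; exact: apart_nil.
Qed.

Lemma apart_right_strands (R : realType) (n : nat) (T : figure R) :
  tangle n T -> apart (map_figure (place 2^-1 0) T) (hsum_strands R).
Proof.
move=> tT; rewrite /hsum_strands; have pf := planar_place (2^-1 : R) 0.
do 2![apply: apart_cons; [apply: (apart_outside pf tT); outside|]].
apply: apart_cons; first at_snd pf tT (NW_corner R).
apply: apart_cons; first at_snd pf tT (SW_corner R).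
apply: apart_cons; first at_fst pf tT (NE_corner R).
apply: apart_cons; first at_fst pf tT (SE_corner R).
exact: apart_nil.
Qed.

Ltac disjoint_edges :=
  try (apply: apart_cons; [by apply: apart_edge => s t /= ? ? [] *; lra
                          |disjoint_edges]).

Lemma hsum_strands_regular (R : realType) :
  regular (hsum_strands R) /\ simple (hsum_strands R).
Proof.
rewrite /hsum_strands.
do 6! [apply: regular_simple_cons;
  [by apply/eqP => -[] *; lra|by disjoint_edges; exact: apart_nil|]].
exact: regular_simple_nil.
Qed.

(** The degrees in a horizontal sum, for abstract corners a, b, c, d in the
    order of [corners]: the last list consists of the ends of the six connecting
    segments, which complete the corners of the two summands to degree two. *)
Lemma perm_gluing (T : eqType) (l r : T -> T) (a b c d : T) (s s' : seq T) :
  let C := [:: a; b; c; d] in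
  let t := map l (C ++ s) ++ map r (C ++ s') in
  perm_eq (map l (C ++ s ++ s) ++ map r (C ++ s' ++ s') ++
           [:: a; c; l b; l d; r b; r d; l a; l c; r a; r c; b; d])
          (C ++ t ++ t).
Proof.
apply/permP => p.
by do 4! rewrite /= ?(map_cat, count_cat, cat_cons); lia.
Qed.

Lemma perm_swap23 (T : eqType) (a b c d : T) :
  perm_eq [:: a; c; b; d] [:: a; b; c; d].
Proof. by apply/permP => p /=; lia. Qed.

Lemma perm_swap_pairs (T : eqType) (a b c d : T) :
  perm_eq [:: c; d; a; b] [:: a; b; c; d].
Proof. by apply/permP => p /=; lia. Qed.

Lemma hsum_strands_in_square (R : realType) (p : space R) :
  point_set (hsum_strands R) p -> in_square p.
Proof.
rewrite /hsum_strands !point_set_cons point_set_nil /in_square.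
by move=> [|[|[|[|[|[|//]]]]]] /edgeP[t t01 ->]; split=> /=; lra.
Qed.

Lemma hsumE (R : realType) (S T : figure R) :
  (S + T)%tangle = map_figure (place (- 2^-1) 0) S ++
    (map_figure (place 2^-1 0) T ++ hsum_strands R).
Proof. by []. Qed.

(** Everything follows from the gluing lemmas, the pieces being apart.  The
    interior vertices of the sum are all vertices of the two copies, including
    the images of the corners. *)
Lemma tangle_hsum (R : realType) (m n : nat) (S T : figure R) :
  tangle m S -> tangle n T -> tangle (m + n) (S + T)%tangle.
Proof.
move=> tS tT; have pl := planar_place (- 2^-1 : R) 0.
have pr := planar_place (2^-1 : R) 0.
have aST : apart (map_figure (place (- 2^-1) 0) S)
                 (map_figure (place 2^-1 0) T ++ hsum_strands R).
  apply: apart_catr; last exact: apart_left_strands tS.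
  by apply: (apart_places tS tT) => -[[? ?] ?] [[? ?] ?] [/= ? ?] [/= ? ?] [] *; lra.
have aT := apart_right_strands tT.
have [rR sR] := hsum_strands_regular R.
rewrite hsumE; split.
- apply: regular_cat aST; first exact: regular_map (tangle_regular tS).
  by apply: regular_cat aT => //; exact: regular_map (tangle_regular tT).
- move=> p; rewrite !point_set_cat !point_set_map // => -[|[|]].
  + by move=> [q /(tangle_in_square tS)[? ?] <-]; split=> /=; lra.
  + by move=> [q /(tangle_in_square tT)[? ?] <-]; split=> /=; lra.
  + exact: hsum_strands_in_square.
- have [s sE sU] := tangle_ends tS; have [s' s'E s'U] := tangle_ends tT.
  exists (map (place (- 2^-1) 0) (corners R ++ s) ++
          map (place 2^-1 0) (corners R ++ s')).
    apply: perm_trans (perm_vertices_cat _ (_ ++ hsum_strands R)) _.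
    apply: perm_trans (perm_cat (perm_refl _) (perm_vertices_cat _ _)) _.
    rewrite !vertices_map.
    apply: perm_trans (perm_cat (perm_map _ sE)
                         (perm_cat (perm_map _ s'E) (perm_refl _))) _.
    exact: perm_gluing.
  rewrite cat_uniq; apply/and3P; split.
  + by move: sU; rewrite cat_uniq => /andP[].
  + apply/hasPn => x; rewrite mem_cat => xH; apply/negP => xC.
    (* Corners have abscissa 1 or -1, while the copies of the summands lie over
       abscissas of absolute value at most 3/4. *)
    have {xC} : x.1.1 = 1 \/ x.1.1 = -1.
      by move: xC; rewrite !inE => /or4P[] /eqP ->; [right|left|right|left].
    by case/orP: xH => /mapP[u uH ->];
      [have := ends_in_square tS sE uH|have := ends_in_square tT s'E uH];
      rewrite /in_square /=; lra.
  + rewrite cat_uniq !map_inj_uniq; [|exact: planar_inj..].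
    rewrite sU s'U andbT; apply/hasPn => _ /mapP[u us' ->]; apply/negP.
    move=> /mapP[v vs [] /= ? _ _].
    have := ends_in_square tS sE vs; have := ends_in_square tT s'E us'.
    by rewrite /in_square /=; lra.
- apply: crossings_le_cat => //; first exact: crossings_le_map (tangle_crossings tS).
  rewrite -[n]addn0; apply: crossings_le_cat => //.
    exact: crossings_le_map (tangle_crossings tT).
  exact: crossings_le_simple.
Qed.

Lemma tangle_map (R : realType) (f : space R -> space R) (n : nat) (T : figure R) :
  planar f -> perm_eq (map f (corners R)) (corners R) ->
  (forall p, in_square p -> in_square (f p)) ->
  tangle n T -> tangle n (map_figure f T).
Proof.
move=> pf fC fI tT; split.
- exact: regular_map (tangle_regular tT).
- by move=> p; rewrite point_set_map // => -[q /(tangle_in_square tT) qI <-]; exact: fI.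
- have [s sE sU] := tangle_ends tT; exists (map f s).
    rewrite vertices_map; apply: (perm_trans (perm_map f sE)).
    by rewrite !map_cat perm_cat2r.
  rewrite (perm_uniq (_ : perm_eq _ (map f (corners R ++ s)))).
    by rewrite map_inj_uniq //; exact: planar_inj.
  by rewrite map_cat perm_cat2r perm_sym.
- exact: crossings_le_map (tangle_crossings tT).
Qed.

Lemma map_flip_corners (R : realType) :
  map (@flip R) (corners R) = [:: NW; SW; NE; SE].
Proof. by rewrite /corners /= /flip /NW /NE /SW /SE /= !opprK. Qed.

Lemma tangle_flip (R : realType) (n : nat) (T : figure R) :
  tangle n T -> tangle n (map_figure (@flip R) T).
Proof.
apply: tangle_map; first exact: planar_flip.
  by rewrite map_flip_corners; exact: perm_swap23.
by move=> p [? ?]; split=> /=; lra.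
Qed.

Lemma tangle_mirror (R : realType) (n : nat) (T : figure R) :
  tangle n T -> tangle n (map_figure (@mirror R) T).
Proof.
apply: tangle_map; first exact: planar_mirror.
  rewrite /corners /= /mirror /NW /NE /SW /SE /= !opprK.
  exact: perm_swap_pairs.
by move=> p [? ?]; split=> /=; lra.
Qed.

Lemma tangle_switch (R : realType) (n : nat) (T : figure R) :
  tangle n T -> tangle n (- T)%tangle.
Proof.
apply: (@tangle_map _ (@reflect_height R)); first exact: planar_reflect_height.
  by rewrite /corners /= /reflect_height /NW /NE /SW /SE /= !oppr0.
by [].
Qed.

(** Reflecting the summands, adding them side by side and reflecting back gives
    the vertical sum, edge by edge and in the same order. *)
Lemma vsumE (R : realType) (S T : figure R) :
  (S * T)%tangle =
  map_figure (@flip R) (map_figure (@flip R) S + map_figure (@flip R) T)%tangle.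
Proof.
rewrite /hsum /vsum /map_figure !map_cat -!map_comp; congr (_ ++ (_ ++ _)).
- by apply: eq_map => -[[[x y] z] [[x' y'] z']]; congr (_, _, _, (_, _, _)) => /=; ring.
- by apply: eq_map => -[[[x y] z] [[x' y'] z']]; congr (_, _, _, (_, _, _)) => /=; ring.
- by rewrite /flip /place /NW /NE /SW /SE /=;
   do ![congr (_ :: _)]; congr (_, _, _, (_, _, _)); field.
Qed.

Lemma tangle_vsum (R : realType) (m n : nat) (S T : figure R) :
  tangle m S -> tangle n T -> tangle (m + n) (S * T)%tangle.
Proof.
by move=> tS tT; rewrite vsumE; apply/tangle_flip/tangle_hsum; exact: tangle_flip.
Qed.

(** * The tangles 1 and -1 *)

Definition overstrand (R : realType) : figure R :=
  [:: (NW, (- 2^-1, 2^-1, 1)); ((- 2^-1, 2^-1, 1), SE)].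

(** The second half of the overstrand passes over the origin after a third of
    its length, at height 2/3. *)
Lemma tangle1_crossing (R : realType) (p q : space R) :
  point_set (overstrand R) p -> point_set [:: (SW, NE)] q -> p.1 = q.1 ->
  p = (0, 0, 2 / 3) /\ q = (0, 0, 0).
Proof.
rewrite /overstrand !point_set_cons point_set_nil.
move=> [|[|//]] /edgeP[s s01 ->] [|//] /edgeP[t t01 ->] [] /= e1 e2.
  by exfalso; lra.
by split; congr (_, _, _) => /=; lra.
Qed.

(** The vertices of the tangle 1, with x for the apex of the overstrand. *)
Lemma perm_tangle1 (T : eqType) (a b c d x : T) :
  perm_eq [:: a; x; c; x; d; b] ([:: a; b; c; d] ++ [:: x] ++ [:: x]).
Proof. by apply/permP => p /=; lia. Qed.

Lemma tangle_tangle1 (R : realType) : tangle 1 (tangle1 R).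
Proof.
pose U : space R * space R := (SW, NE).
have neU : U.1.1 != U.2.1 by apply/eqP => -[] *; lra.
have [rO sO] : regular (overstrand R) /\ simple (overstrand R).
  apply: regular_simple_cons; first by apply/eqP => -[] *; lra.
    by apply: apart_joint => s t /= ? ? [] *; split; lra.
  apply: regular_simple_cons; first by apply/eqP => -[] *; lra.
    exact: apart_nil.
  exact: regular_simple_nil.
have sU := simple1 neU; have rU := regular1 neU.
rewrite (_ : tangle1 R = overstrand R ++ [:: (SW, NE)]) //; split.
- apply: regular_cross => // p q pO qU pq.
  have [-> ->] := tangle1_crossing pO qU pq; clear; split.
  + by move=> [] *; lra.
  + by rewrite /vertices /= !inE; apply/negP => /or4P[] /eqP[] *; lra.
  + by rewrite /vertices /= !inE; apply/negP => /orP[] /eqP[] *; lra.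
- move=> p; rewrite /= !point_set_cons point_set_nil.
  by move=> [|[|[|//]]] /edgeP[t t01 ->]; split=> /=; lra.
- exists [:: (- 2^-1, 2^-1, 1)].
    exact: perm_tangle1.
  (* The five vertices already differ in the projection. *)
  have neq (x y : space R) : x.1 <> y.1 -> (x == y) = false.
    by move=> xy; apply/eqP => xy'; apply: xy; rewrite xy'.
  rewrite /= !inE !neq //= => -[] *; lra.
- exists [:: (0, 0)] => // c [p [q []]]; rewrite !point_set_cat /= inE.
  (* Only the two mixed cases are crossings, and they lie over the origin. *)
  move=> [] pH [] qH ne pc qc; first by case: ne; apply: sO; rewrite // pc.
  + by have [e _] := tangle1_crossing pH qH (etrans pc (esym qc)); rewrite -pc e.
  + by have [e _] := tangle1_crossing qH pH (etrans qc (esym pc)); rewrite -qc e.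
  + by case: ne; apply: sU; rewrite // pc.
Qed.

Lemma tangleN1E (R : realType) : tangleN1 R = map_figure (@mirror R) (tangle1 R).
Proof. by rewrite /tangleN1 /tangle1 /map_figure /= /mirror /NW /NE /SW /SE /= opprK. Qed.

Lemma tangle_tangleN1 (R : realType) : tangle 1 (tangleN1 R).
Proof. by rewrite tangleN1E; apply: tangle_mirror; exact: tangle_tangle1. Qed.

(** * Components of tangles *)

(** Being in the same component is expressed as equality of components, so that
    chains of arcs are followed by mere congruence. *)
Definition component_of (R : realType) (D : figure R) (p : space R) : set (R * R * R) :=
  connected_component (point_set D : set (R * R * R)) p.

Lemma edge_connected (R : realType) (e : space R * space R) :
  connected (edge e).
Proof.
have -> : edge e = (fun t : R => lerp t e.1 e.2 : R * R * R) @` `[0, 1] by [].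
apply: connected_continuous_connected; first exact: segment_connected.
by apply: continuous_subspaceT; exact: lerp_continuous.
Qed.

Lemma component_eq (R : realType) (D : figure R) (A : set (R * R * R))
    (p q : space R) :
  connected A -> A `<=` point_set D -> A p -> A q ->
  component_of D p = component_of D q.
Proof.
by move=> cA AD Ap Aq; apply: same_connected_component; exists A.
Qed.

Lemma component_edge (R : realType) (D : figure R) (e : space R * space R)
    (p q : space R) :
  e \in D -> edge e p -> edge e q -> component_of D p = component_of D q.
Proof.
by move=> eD; apply: component_eq; [exact: edge_connected|move=> x ex; exists e].
Qed.

(** The image of the component of p is connected and contains both images; f need
    only map the first figure into the second, which covers the inclusion of a
    tangle into a sum. *)
Lemma component_map (R : realType) (f : space R -> space R) (D E : figure R)
    (p q : space R) :
  planar f -> f @` point_set D `<=` point_set E -> point_set D p ->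
  component_of D p = component_of D q ->
  component_of E (f p) = component_of E (f q).
Proof.
move=> pf fDE pD pq.
apply: (@component_eq _ _ (f @` component_of D p)).
- apply: connected_continuous_connected; first exact: component_connected.
  by apply: continuous_subspaceT; exact: planar_continuous.
- move=> _ [x /connected_component_sub xD <-]; apply: fDE; by exists x.
- by exists p => //; exact: connected_component_refl.
- exists q => //; apply: connected_component_sym; rewrite -/(component_of D q) -pq.
  exact: connected_component_refl.
Qed.

(** The tangle joins a to b and c to d, and every component contains one of these
    two strands, so there are no closed components.  The two strands may be
    connected to each other: this does no harm, as the aim is connectedness. *)
Record wired (R : realType) (T : figure R) (a b c d : space R) : Prop := Wired {
  wired_fst : point_set T a;
  wired_snd : point_set T c;
  wired_strand1 : component_of T a = component_of T b;
  wired_strand2 : component_of T c = component_of T d;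
  wired_cover : forall p, point_set T p ->
    component_of T p = component_of T a \/ component_of T p = component_of T c }.

Definition horizontal_type (R : realType) (T : figure R) := wired T NW NE SW SE.
Definition vertical_type (R : realType) (T : figure R) := wired T NW SW NE SE.
Definition diagonal_type (R : realType) (T : figure R) := wired T NW SE SW NE.

Lemma component_eq_mem (R : realType) (D : figure R) (p q : space R) :
  point_set D p -> component_of D p = component_of D q -> point_set D q.
Proof.
move=> pD pq; apply: (@connected_component_sub _ (point_set D) p).
apply: connected_component_sym; rewrite -/(component_of D q) -pq.
exact: connected_component_refl.
Qed.

Lemma wired_swap (R : realType) (T : figure R) (a b c d : space R) :
  wired T a b c d -> wired T c d a b.
Proof. by move=> [aT cT ab cd cov]; split=> // p /cov[]; [right|left]. Qed.

Lemma wired_turn (R : realType) (T : figure R) (a b c d : space R) :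
  wired T a b c d -> wired T a b d c.
Proof.
move=> [aT cT ab cd cov]; split=> //; first exact: component_eq_mem cd.
by move=> p /cov; rewrite -cd.
Qed.

Lemma wired_map (R : realType) (f : space R -> space R) (T : figure R)
    (a b c d : space R) :
  planar f -> wired T a b c d -> wired (map_figure f T) (f a) (f b) (f c) (f d).
Proof.
move=> pf [aT cT ab cd cov].
have fT : f @` point_set T `<=` point_set (map_figure f T).
  by rewrite point_set_map.
split; [by apply: fT; exists a|by apply: fT; exists c| | |].
- exact: component_map ab.
- exact: component_map cd.
- move=> p; rewrite point_set_map // => -[q qT <-].
  by have [e|e] := cov q qT; [left|right]; exact: component_map e.
Qed.

(** The combinatorial core of the computation of types: only the equalities of
    components coming from the connecting segments and from the strands of the
    summands are used, so K is an arbitrary map satisfying them.  The list at the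
    end meets every piece of the sum: the first six points are the starting
    points of the connecting segments, the other four represent the strands of
    the summands. *)
Lemma hsum_wired (R : realType) (S T : figure R) (a b c d a' b' c' d' x y z w : space R) :
  let l := place (- 2^-1) 0 in
  let r := place 2^-1 0 in
  wired S a b c d -> wired T a' b' c' d' ->
  x \in corners R -> z \in corners R ->
  (forall K : space R -> set (R * R * R),
     [/\ K NW = K (l NW), K SW = K (l SW) & K (l NE) = K (r NW)] ->
     [/\ K (l SE) = K (r SW), K (r NE) = K NE & K (r SE) = K SE] ->
     [/\ K (l a) = K (l b), K (l c) = K (l d), K (r a') = K (r b')
       & K (r c') = K (r d')] ->
     [/\ K x = K y, K z = K w
       & forall p, p \in [:: NW; SW; l NE; l SE; r NE; r SE; l a; l c; r a'; r c'] ->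
           K p = K x \/ K p = K z]) ->
  wired (S + T)%tangle x y z w.
Proof.
move=> l r wS wT xC zC; set D := (S + T)%tangle; set K := component_of D.
have pl : planar l by exact: planar_place.
have pr : planar r by exact: planar_place.
have DE : point_set D = point_set (map_figure l S) `|`
    (point_set (map_figure r T) `|` point_set (hsum_strands R)).
  by rewrite -!point_set_cat.
have lD : l @` point_set S `<=` point_set D.
  by rewrite DE point_set_map // => p; left.
have rD : r @` point_set T `<=` point_set D.
  by rewrite DE [point_set (map_figure r T)]point_set_map // => p; right; left.
have strand i p : (i < 6)%N -> let e := nth (NW, NW) (hsum_strands R) i in
    edge e p -> K p = K e.1.
  move=> i6 e ep; apply: (@component_edge _ _ e) => //; last exact: edge_fst.
  by rewrite /D hsumE !mem_cat; apply/orP; right; apply/orP; right; exact: mem_nth.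
have strands i : (i < 6)%N -> let e := nth (NW, NW) (hsum_strands R) i in
    K e.1 = K e.2.
  by move=> i6 e; rewrite (strand i e.2) //; exact: edge_snd.
have [aS cS ab cd covS] := wS; have [aT cT ab' cd' covT] := wT.
move=> /(_ K)[].
- by split; [exact: (strands 0%N)|exact: (strands 1%N)|exact: (strands 2%N)].
- by split; [exact: (strands 3%N)|exact: (strands 4%N)|exact: (strands 5%N)].
- by split; [exact: component_map ab|exact: component_map cd
            |exact: component_map ab'|exact: component_map cd'].
move=> xy zw cov.
(* In [vertices (hsum_strands R)], NW and SW are the first ends of the segments
   0 and 1, and NE and SE the second ends of the segments 4 and 5. *)
have corner_in c0 : c0 \in corners R -> point_set D c0.
  move=> c0C; rewrite DE; right; right; move: c0C.
  have mem i := @mem_nth _ NW (vertices (hsum_strands R)) i.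
  by rewrite !inE => /or4P[] /eqP ->; apply: vertices_point_set;
    [exact: (mem 0%N isT)|exact: (mem 10%N isT)
    |exact: (mem 1%N isT)|exact: (mem 11%N isT)].
split=> //; [exact: corner_in|exact: corner_in|].
have {}cov p : p \in [:: NW; SW; l NE; l SE; r NE; r SE; l a; l c; r a'; r c'] ->
  K p = K x \/ K p = K z by exact: cov.
have cov1 i : (i < 10)%N ->
    let p := nth NW [:: NW; SW; l NE; l SE; r NE; r SE; l a; l c; r a'; r c'] i in
    K p = K x \/ K p = K z.
  by move=> i10; apply: cov; exact: mem_nth.
rewrite DE => p [|[|]].
- rewrite point_set_map // => -[q qS <-].
  have [e|e] := covS q qS; have := component_map pl lD qS e;
    rewrite -!/(K _) => ->.
    exact: (cov1 6%N isT).
  exact: (cov1 7%N isT).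
- rewrite point_set_map // => -[q qT <-].
  have [e|e] := covT q qT; have := component_map pr rD qT e;
    rewrite -!/(K _) => ->.
    exact: (cov1 8%N isT).
  exact: (cov1 9%N isT).
- move=> [e /(nthP (NW, NW))[i i6 <-] ep]; rewrite -/K (strand i p i6 ep).
  have := cov1 i (leq_trans i6 (isT : (6 <= 10)%N)).
  by move: i i6 {ep} => [|[|[|[|[|[|//]]]]]].
Qed.

Ltac wire wS wT xC zC :=
  apply: (hsum_wired wS wT xC zC) => K [? ? ?] [? ? ?] [? ? ? ?];
  split; [congruence|congruence|
    move=> ?; rewrite !inE; do 9?[case/orP]; move/eqP => ->;
    first [left; congruence|right; congruence]].

(** In the names below, H, V and D abbreviate the three types. *)
Lemma hsum_DD (R : realType) (S T : figure R) :
  diagonal_type S -> diagonal_type T -> horizontal_type (S + T)%tangle.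
Proof. by move=> wS wT; wire wS wT (NW_corner R) (SW_corner R). Qed.

Lemma hsum_VD (R : realType) (S T : figure R) :
  vertical_type S -> diagonal_type T -> vertical_type (S + T)%tangle.
Proof. by move=> wS wT; wire wS wT (NW_corner R) (NE_corner R). Qed.

Lemma hsum_HV (R : realType) (S T : figure R) :
  horizontal_type S -> vertical_type T -> vertical_type (S + T)%tangle.
Proof. by move=> wS wT; wire wS wT (NW_corner R) (NE_corner R). Qed.

Lemma hsum_HD (R : realType) (S T : figure R) :
  horizontal_type S -> diagonal_type T -> diagonal_type (S + T)%tangle.
Proof. by move=> wS wT; wire wS wT (NW_corner R) (SW_corner R). Qed.

Lemma hsum_DV (R : realType) (S T : figure R) :
  diagonal_type S -> vertical_type T -> vertical_type (S + T)%tangle.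
Proof. by move=> wS wT; wire wS wT (NW_corner R) (NE_corner R). Qed.

Lemma hsum_HH (R : realType) (S T : figure R) :
  horizontal_type S -> horizontal_type T -> horizontal_type (S + T)%tangle.
Proof. by move=> wS wT; wire wS wT (NW_corner R) (SW_corner R). Qed.

Lemma flip_corners (R : realType) :
  [/\ flip NW = NW :> space R, flip NE = SW :> space R,
      flip SW = NE :> space R & flip SE = SE :> space R].
Proof. by rewrite /flip /NW /NE /SW /SE /= !opprK. Qed.

Lemma horizontal_flip (R : realType) (T : figure R) :
  horizontal_type T -> vertical_type (map_figure (@flip R) T).
Proof.
by move/(wired_map (planar_flip R)); have [-> -> -> ->] := flip_corners R.
Qed.

Lemma vertical_flip (R : realType) (T : figure R) :
  vertical_type T -> horizontal_type (map_figure (@flip R) T).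
Proof.
by move/(wired_map (planar_flip R)); have [-> -> -> ->] := flip_corners R.
Qed.

Lemma diagonal_flip (R : realType) (T : figure R) :
  diagonal_type T -> diagonal_type (map_figure (@flip R) T).
Proof.
move/(wired_map (planar_flip R)); have [-> -> -> ->] := flip_corners R.
exact: wired_turn.
Qed.

Lemma vsum_DD (R : realType) (S T : figure R) :
  diagonal_type S -> diagonal_type T -> vertical_type (S * T)%tangle.
Proof.
move=> dS dT; rewrite vsumE; apply: horizontal_flip.
by apply: hsum_DD; exact: diagonal_flip.
Qed.

Lemma vsum_VH (R : realType) (S T : figure R) :
  vertical_type S -> horizontal_type T -> horizontal_type (S * T)%tangle.
Proof.
move=> vS hT; rewrite vsumE; apply: vertical_flip.
by apply: hsum_HV; [exact: vertical_flip|exact: horizontal_flip].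
Qed.

Lemma vsum_DH (R : realType) (S T : figure R) :
  diagonal_type S -> horizontal_type T -> horizontal_type (S * T)%tangle.
Proof.
move=> dS hT; rewrite vsumE; apply: vertical_flip.
by apply: hsum_DV; [exact: diagonal_flip|exact: horizontal_flip].
Qed.

Lemma horizontal_switch (R : realType) (T : figure R) :
  horizontal_type T -> horizontal_type (- T)%tangle.
Proof.
move/(wired_map (planar_reflect_height R)).
by rewrite /reflect_height /NW /NE /SW /SE /= !oppr0.
Qed.

Lemma diagonal_tangle1 (R : realType) : diagonal_type (tangle1 R).
Proof.
have edgeD i : (i < 3)%N -> let e := nth (NW, NW) (tangle1 R) i in
    component_of (tangle1 R) e.1 = component_of (tangle1 R) e.2.
  move=> i3 e; apply: (@component_edge _ _ e); [exact: mem_nth|exact: edge_fst|exact: edge_snd].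
have NWE := edgeD 0%N isT; have SEE := edgeD 1%N isT; have SWE := edgeD 2%N isT.
split.
- exact: vertices_point_set (tangle_corner (tangle_tangle1 R) (NW_corner R)).
- exact: vertices_point_set (tangle_corner (tangle_tangle1 R) (SW_corner R)).
- by rewrite [LHS]NWE SEE.
- exact: SWE.
- move=> p [e /(nthP (NW, NW))[i i3 <-] ep].
  rewrite (@component_edge _ _ _ p _ (mem_nth _ i3) ep (edge_fst _)).
  by move: i i3 {ep} => [|[|[|//]]] _; [left|left; rewrite NWE|right].
Qed.

Lemma diagonal_tangleN1 (R : realType) : diagonal_type (tangleN1 R).
Proof.
rewrite tangleN1E.
have /(wired_map (planar_mirror R)) := diagonal_tangle1 R.
rewrite /mirror /NW /NE /SW /SE /= !opprK; exact: wired_swap.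
Qed.

(** * The tangles T10 and M_r *)

(** The crossings add up as ((((2 + 1) + 2) + 3) + 2), and the types combine as
    (((V + D) * H) + D) * H = ((V * H) + D) * H = (H + D) * H = D * H = H. *)
Lemma T10_tangle (R : realType) : tangle 10 (T10 R) /\ horizontal_type (T10 R).
Proof.
have [t1 tN] := (tangle_tangle1 R, tangle_tangleN1 R).
have [d1 dN] := (diagonal_tangle1 R, diagonal_tangleN1 R).
have t2 : tangle 2 (tangle_pos R 2) by exact: (tangle_hsum t1 t1).
have h2 : horizontal_type (tangle_pos R 2) by exact: (hsum_DD d1 d1).
split.
  apply: (@tangle_vsum _ 8 2 _ _ _ t2); apply: (@tangle_hsum _ 5 3).
    apply: (@tangle_vsum _ 3 2 _ _ _ t2); apply: (@tangle_hsum _ 2 1 _ _ _ t1).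
    exact: (tangle_vsum t1 t1).
  exact: (tangle_hsum (tangle_hsum tN tN) tN).
apply: (vsum_DH _ h2); apply: hsum_HD.
  by apply: (vsum_VH _ h2); apply: (hsum_VD _ d1); exact: vsum_DD.
by apply: (hsum_HD _ dN); exact: hsum_DD.
Qed.

Lemma M_tangle (R : realType) (r : nat) :
  tangle (2 ^ r.-1 * 20) (M R r) /\ horizontal_type (M R r).
Proof.
have [t10 h10] := T10_tangle R.
have [t20 h20] : tangle 20 (T20 R) /\ horizontal_type (T20 R).
  split; first exact: (tangle_hsum t10 (tangle_switch t10)).
  exact: (hsum_HH h10 (horizontal_switch h10)).
(* [M R 0] and [M R 1] are both T20, in accordance with [0.-1 = 1.-1]. *)
elim: r => [//|[//|r] [tM hM]]; split; last exact: (hsum_HH hM hM).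
have -> : (2 ^ r.+2.-1 * 20 = 2 ^ r.+1.-1 * 20 + 2 ^ r.+1.-1 * 20)%N.
  by rewrite /= expnS mul2n -addnn mulnDl.
exact: (tangle_hsum tM tM).
Qed.

(** * Denominators *)

(** The two outer arcs of the denominator, each bent at a vertex of abscissa -2
    or 2. *)
Definition den_strands (R : realType) : figure R :=
  let w := (-2, 0, 0) in
  let e := (2, 0, 0) in
  [:: (NW, w); (w, SW); (NE, e); (e, SE)].

Lemma planar_id (R : realType) : planar (@id (space R)).
Proof. by split=> // p; exact: cvg_id. Qed.

Lemma map_figure_id (R : realType) (T : figure R) : map_figure id T = T.
Proof. by rewrite /map_figure -[RHS]map_id; apply: eq_map => -[]. Qed.

Lemma apart_den_strands (R : realType) (n : nat) (T : figure R) :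
  tangle n T -> apart T (den_strands R).
Proof.
move=> tT; rewrite -[T]map_figure_id /den_strands; have pf := planar_id R.
apply: apart_cons; first at_fst pf tT (NW_corner R).
apply: apart_cons; first at_snd pf tT (SW_corner R).
apply: apart_cons; first at_fst pf tT (NE_corner R).
apply: apart_cons; first at_snd pf tT (SE_corner R).
exact: apart_nil.
Qed.

Lemma den_strands_regular (R : realType) :
  regular (den_strands R) /\ simple (den_strands R).
Proof.
rewrite /den_strands.
apply: regular_simple_cons; first by apply/eqP => -[] *; lra.
  apply: apart_cons; last by disjoint_edges; exact: apart_nil.
  by apply: apart_joint => s t /= ? ? [] *; split; lra.
apply: regular_simple_cons; first by apply/eqP => -[] *; lra.
  by disjoint_edges; exact: apart_nil.
apply: regular_simple_cons; first by apply/eqP => -[] *; lra.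
  apply: apart_cons; last exact: apart_nil.
  by apply: apart_joint => s t /= ? ? [] *; split; lra.
apply: regular_simple_cons; [by apply/eqP => -[] *; lra|exact: apart_nil|].
exact: regular_simple_nil.
Qed.

(** The outer arcs raise the degree of the corners a, b, c, d from one to two;
    w and e are their bends. *)
Lemma perm_closing (T : eqType) (a b c d w e : T) (s : seq T) :
  let t := [:: w; e] ++ [:: a; b; c; d] ++ s in
  perm_eq (([:: a; b; c; d] ++ s ++ s) ++ [:: a; w; b; e; w; c; e; d]) (t ++ t).
Proof.
apply/permP => p.
by do 4! rewrite /= ?(count_cat, cat_cons); lia.
Qed.

(** The outer arcs lie outside the open square, so they are apart from the
    tangle, and they complete the corners to degree two. *)
Lemma link_diagram_den (R : realType) (n : nat) (T : figure R) :
  tangle n T -> link_diagram (den T) /\ crossings_le (den T) n.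
Proof.
move=> tT; have aT := apart_den_strands tT.
have [rE sE] := den_strands_regular R.
have [uD nD mD pD] : regular (T ++ den_strands R).
  exact: regular_cat (tangle_regular tT) rE aT.
rewrite (_ : den T = T ++ den_strands R) //; split; last first.
  rewrite -[n]addn0; apply: crossings_le_cat aT (tangle_crossings tT) _.
  exact: crossings_le_simple.
split=> //; split=> // v.
have [s perm_s uniq_s] := tangle_ends tT.
set t := [:: (-2, 0, 0); (2, 0, 0)] ++ corners R ++ s.
have tE : perm_eq (vertices (T ++ den_strands R)) (t ++ t).
  apply: perm_trans (perm_vertices_cat _ _) _.
  by apply: perm_trans (perm_cat perm_s (perm_refl _)) _; exact: perm_closing.
have out x := @ends_in_square _ _ _ _ x tT perm_s.
have tU : uniq t.
  rewrite [t](_ : _ = [:: (-2, 0, 0), (2, 0, 0) & corners R ++ s]) // 2!cons_uniq.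
  rewrite uniq_s andbT in_cons negb_or -andbA.
  apply/and3P; split.
  - by apply/eqP => -[] *; lra.
  - by apply/negP => /out[] /= ? _; lra.
  - by apply/negP => /out[] /= ? _; lra.
rewrite (perm_mem tE) (permP tE) mem_cat orbb count_cat => vt.
by rewrite (count_uniq_mem _ tU) vt.
Qed.

(** The west arc joins NW to SW, that is, the two strands to each other; the
    diagram is therefore connected. *)
Lemma den_knot (R : realType) (T : figure R) :
  horizontal_type T -> is_knot (point_set (den T)).
Proof.
move=> [NWT SWT NWE SWE cov]; set D := den T.
have DE : D = T ++ den_strands R by [].
have TD : id @` point_set T `<=` point_set D.
  by rewrite image_id DE point_set_cat => p; left.
have strand i p : (i < 4)%N -> let e := nth (NW, NW) (den_strands R) i in
    edge e p -> component_of D p = component_of D e.1.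
  move=> i4 e ep; apply: (@component_edge _ _ e) => //; last exact: edge_fst.
  by rewrite DE mem_cat; apply/orP; right; exact: mem_nth.
have w1 := strand 0%N (-2, 0, 0) isT (edge_snd _).
have w2 := strand 1%N SW isT (edge_snd _).
have e1 := strand 2%N (2, 0, 0) isT (edge_snd _).
have NE1 : component_of D NW = component_of D NE.
  exact: (component_map (planar_id R) TD NWT NWE).
have SW1 : component_of D SW = component_of D NW by rewrite w2 [LHS]w1.
have all1 p : point_set D p -> component_of D p = component_of D NW.
  rewrite DE point_set_cat => -[pT|[e /(nthP (NW, NW))[i i4 <-] ep]].
    by have [c|c] := cov p pT; have := component_map (planar_id R) TD pT c;
      rewrite /= -?DE ?SW1.
  rewrite -DE (strand i p i4 ep); move: i i4 {ep} => [|[|[|[|//]]]] _ //=.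
  by rewrite [LHS]e1.
rewrite /is_knot (_ : components _ = [set component_of D NW]).
  exact: card_set1.
apply/seteqP; split=> C /=.
  by move=> [p pD <-]; exact: all1.
move=> ->; exists NW => //.
by rewrite DE point_set_cat; left.
Qed.

Lemma isotopic_refl (R : realType) (K : set (R * R * R)) : isotopic K K.
Proof.
exists snd; split=> //.
- by apply: continuous_subspaceT => p; exact: cvg_snd.
- by move=> t _; exists id; split=> // p; exact: cvg_id.
- by rewrite image_id.
Qed.

(** Some number of crossings is attained, namely by D itself, so there is a least
    one, which is at most that of D. *)
Lemma at_most_crossings_diagram (R : realType) (D : figure R) (n : nat) :
  link_diagram D -> crossings_le D n -> at_most_crossings (point_set D) n.
Proof.
move=> lD /crossings_finite[m mn Dm].
pose P k := `[< exists2 E, diagram_of E (point_set D) & crossings E #= `I_k >].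
have Pm : P m by apply/asboolP; exists D => //; split=> //; exact: isotopic_refl.
have exP : exists k, P k by exists m.
case: (ex_minnP exP) => c /asboolP Pc cmin; exists c; last exact: leq_trans (cmin _ Pm) mn.
by split=> // E k dE Ek; apply: cmin; apply/asboolP; exists E.
Qed.

Theorem proposition3p3 (R : realType) (r : nat) (r_ge1 : (1 <= r)%N) :
  let D : figure R := den (tangle1 R * M R r)%tangle in
  link_diagram D /\
  is_knot (point_set D) /\
  at_most_crossings (point_set D) (1 + 2 ^ (r - 1) * 20)%N.
Proof.
move=> D; have [tM hM] := M_tangle R r.
have [lD cD] := link_diagram_den (tangle_vsum (tangle_tangle1 R) tM).
split=> //; split; first exact: den_knot (vsum_DH (diagonal_tangle1 R) hM).
by apply: at_most_crossings_diagram; rewrite // subn1.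
Qed.
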